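(* Let $\alpha,\beta,c,h\in\mathbb{C}$. The $\mathrm{Vir}$-module $V'_{\alpha,\beta}\otimes L(c,h)$ is irreducible if and only if $V'_{\alpha,\beta}\otimes L(c,h)$ is cyclic on every $v_m\otimes v$, $m\in\mathbb{Z}$ (that is, for every basis vector $v_m$ of $V'_{\alpha,\beta}$, the single vector $v_m\otimes v$ generates the whole module), where $v$ is the highest weight vector of $L(c,h)$.
   Context: $\mathrm{Vir}$ is the complex Lie algebra with basis $\{C,L_i:i\in\mathbb{Z}\}$, $C$ central, $[L_n,L_m]=(n-m)L_{m+n}+\delta_{m,-n}\frac{n^3-n}{12}C$. The Verma module $V(c,h)$ is the universal $\mathrm{Vir}$-module generated by a vector $v$ with $Cv=cv$, $L_0v=hv$, $L_nv=0$ for $n>0$; $L(c,h)$ is its unique irreducible quotient, with highest weight vector still denoted $v$. For $\alpha,\beta\in\mathbb{C}$, $V_{\alpha,\beta}=\bigoplus_{m\in\mathbb{Z}}\mathbb{C}v_m$ with $L_nv_m=-(m+\alpha+\beta+n\beta)v_{m+n}$, $Cv_m=0$. Since $V_{\alpha,\beta}\cong V_{\alpha+k,\beta}$ for $k\in\mathbb{Z}$, by convention $\alpha$ is taken to be $0$ whenever $\alpha\in\mathbb{Z}$. Put $V'_{0,0}=V_{0,0}/\mathbb{C}v_0$, $V'_{0,1}=\bigoplus_{m\neq-1}\mathbb{C}v_m\subset V_{0,1}$, and $V'_{\alpha,\beta}=V_{\alpha,\beta}$ for all other pairs. The modules $V'_{\alpha,\beta}$ are irreducible. In $V'_{0,0}$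 there is no basis vector $v_0$ and in $V'_{0,1}$ there is no basis vector $v_{-1}$; in these cases statements about ''every $v_m$'' omit these indices. The tensor product has the action $L_n(v_k\otimes x)=(L_nv_k)\otimes x+v_k\otimes(L_nx)$, and $C$ acts as $c$. *)

(* Defs.v *)
From HB Require Import structures.
From mathcomp Require Import all_boot all_order all_algebra.
From mathcomp Require Import generic_quotient ring_quotient.
From mathcomp Require Import finmap monalg complex.
From mathcomp Require Import boolp reals.
From mathcomp Require Import ring zify.

Set Implicit Arguments.
Unset Strict Implicit.
Unset Printing Implicit Defensive.

Import GRing.Theory.
Local Open Scope ring_scope.
Local Open Scope quotient_scope.

Section Combinations.
Variables (K : fieldType) (V : lmodType K).
Implicit Types (a b : K) (u v w : V).

Lemma comb_add a b a' b' u v :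
  (a *: u + b *: v) + (a' *: u + b' *: v) = (a + a') *: u + (b + b') *: v.
Proof. by rewrite addrACA -!scalerDl. Qed.

Lemma comb_sub a u v w u' v' w' : u = v - w -> u' = v' - w' ->
  a *: u + u' = (a *: v + v') - (a *: w + w').
Proof. by move=> -> ->; rewrite opprD addrACA -scalerBr. Qed.

Lemma comb3 a u v w u' v' w' :
  (a *: u + u') + (a *: v + v') + (a *: w + w')
  = a *: (u + v + w) + (u' + v' + w').
Proof. by rewrite (addrACA (a *: u)) -scalerDr addrACA -scalerDr. Qed.

Lemma comb_eq0 a u v u' v' : u + u' = 0 -> v + v' = 0 ->
  (a *: u + v) + (a *: u' + v') = 0.
Proof. by move=> uu' vv'; rewrite addrACA vv' addr0 -scalerDr uu' scaler0. Qed.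

Lemma comb_swap a b u u' v v' w w' :
  b *: ((a *: u + u') + (a *: v + v')) + (a *: w + w') =
  a *: (b *: (u + v) + w) + (b *: (u' + v') + w').
Proof.
rewrite (addrACA (a *: _)) -(scalerDr a) (scalerDr b) addrACA.
by rewrite scalerA mulrC -scalerA -scalerDr.
Qed.

Lemma shuffle8 u v u' v' w w' :
  (u - v) + (u' - v') = (u + w + (w' + u')) - (v + w' + (w + v')).
Proof.
rewrite (addrACA u) -opprD (addrC w' u') (addrC w v') (addrACA u).
by rewrite (addrACA v) (addrC w' w) (addrC (v + v')) addrKA.
Qed.

End Combinations.

Section LinearFunctions.
Variables (K : fieldType) (V W : lmodType K) (f : V -> W).
Hypothesis f_linear : linear f.

Lemma linear_fun0 : f 0 = 0.
Proof. by have := f_linear (-1) 0 0; rewrite scaler0 addr0 scaleN1r addNr. Qed.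

Lemma linear_funZ a u : f (a *: u) = a *: f u.
Proof. by rewrite -[a *: u]addr0 f_linear linear_fun0 addr0. Qed.

Lemma linear_funD u v : f (u + v) = f u + f v.
Proof. by rewrite -[u]scale1r f_linear !scale1r. Qed.

Lemma linear_funB u v : f (u - v) = f u - f v.
Proof. by rewrite addrC -scaleN1r f_linear scaleN1r addrC. Qed.

End LinearFunctions.

(* [{malg K[I]}] is the vector space with basis [<< i >>], i : I; [lext f] is *)
(* the linear extension of [f] from the basis.                                *)
HB.lock Definition lext (K : fieldType) (I : choiceType) (V : lmodType K)
  (f : I -> V) (u : {malg K[I]}) : V := \sum_(i <- msupp u) u@_i *: f i.

Section FreeSpace.
Variables (K : fieldType) (I : choiceType) (V : lmodType K).
Implicit Types (f : I -> V) (u : {malg K[I]}).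

Lemma lextEw f u (d : {fset I}) : (msupp u `<=` d)%fset ->
  lext f u = \sum_(i <- d) u@_i *: f i.
Proof.
move=> sub; rewrite lext.unlock (big_fset_incl _ sub) // => i _ iNu.
by rewrite mcoeff_outdom ?scale0r.
Qed.

Lemma lext_linear f : linear (lext f).
Proof.
move=> a u v; set d := (msupp (a *: u + v) `|` (msupp u `|` msupp v))%fset.
rewrite (@lextEw f _ d) ?fsubsetUl // (@lextEw f u d); last first.
  by rewrite /d fsetUCA fsubsetUl.
rewrite (@lextEw f v d); last by rewrite /d fsetUA fsubsetUr.
rewrite scaler_sumr -big_split /=; apply: eq_bigr => i _.
by rewrite mcoeffD mcoeffZ scalerDl scalerA.
Qed.
HB.instance Definition _ f :=
  GRing.isLinear.Build K {malg K[I]} V *:%R (lext f) (lext_linear f).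

Lemma lextU f i : lext f << i >> = f i.
Proof. by rewrite lext.unlock msuppU oner_eq0 big_seq_fset1 mcoeffUU scale1r. Qed.

Lemma eq_lext f f' : f =1 f' -> lext f =1 lext f'.
Proof. by move=> ff' u; rewrite lext.unlock; apply: eq_bigr => i _; rewrite ff'. Qed.

Lemma lext_comb a f f' u :
  lext (fun i => a *: f i + f' i) u = a *: lext f u + lext f' u.
Proof.
rewrite lext.unlock scaler_sumr -big_split /=; apply: eq_bigr => i _.
by rewrite scalerDr !scalerA mulrC.
Qed.

End FreeSpace.

Lemma malg_ind_lin (K : fieldType) (I : choiceType) (P : {malg K[I]} -> Prop) :
  P 0 -> (forall a i u, P u -> P (a *: << i >> + u)) -> forall u, P u.
Proof.
move=> P0 PD u; rewrite [u]monalgE.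
elim: (X in \sum_(i <- X) _) => [|i s IH]; first by rewrite big_nil.
rewrite big_cons (_ : << u@_i *g i >> = u@_i *: << i >>); first exact: PD.
by apply/malgP => k; rewrite mcoeffZ !mcoeffU mulrnAr mulr1.
Qed.

(* Membership is boolean, but by [asboolP] every subset closed under linear   *)
(* combinations is a subspace.                                                *)
Section Subspaces.
Variables (K : fieldType) (V : lmodType K).

Record subspace := Subspace {
  subspace_pred :> {pred V};
  subspace_closed : submod_closed subspace_pred }.

HB.instance Definition _ (S : subspace) :=
  GRing.isSubmodClosed.Build K V (subspace_pred S)
    (GRing.submod_closed_semi (subspace_closed S)).

Definition span_pred (A : V -> Prop) : {pred V} := fun u =>
  `[< forall S : subspace, (forall a, A a -> a \in S) -> u \in S >].

Lemma span_closed A : submod_closed (span_pred A).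
Proof.
split=> [|a u v /asboolP Su /asboolP Sv]; apply/asboolP => S AS.
  exact: rpred0.
by rewrite rpredD ?rpredZ ?Su ?Sv.
Qed.

Definition span A := Subspace (span_closed A).

Lemma mem_span A u : A u -> u \in span A.
Proof. by move=> Au; apply/asboolP => S; apply. Qed.

Lemma span_sub A (S : subspace) :
  (forall a, A a -> a \in S) -> {subset span A <= S}.
Proof. by move=> AS u /asboolP; apply. Qed.

Definition subspace_sort (S : subspace) : Type := {u : V | u \in S}.
HB.instance Definition _ S := SubChoice.on (subspace_sort S).
HB.instance Definition _ S :=
  [SubChoice_isSubLmodule of subspace_sort S by <:].

Definition quotient_sort (S : subspace) : Type := Quotient.quot (subspace_pred S).

End Subspaces.

Section QuotientSpace.
Variables (K : fieldType) (V : lmodType K) (S : subspace V).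
Local Notation Q := (quotient_sort S).

HB.instance Definition _ := GRing.Zmodule.on Q.

Definition qproj (u : V) : Q := \pi_(Quotient.quot (subspace_pred S)) u.

Lemma qproj_eq u v : qproj u = qproj v <-> u - v \in S.
Proof.
rewrite /qproj; split=> [/eqP|uv]; last apply/eqP; by rewrite -Quotient.idealrBE.
Qed.

Lemma qprojK (q : Q) : qproj (repr q) = q.
Proof. exact: reprK. Qed.

Lemma qproj_repr u : repr (qproj u) - u \in S.
Proof. by apply/qproj_eq; rewrite qprojK. Qed.

Lemma qprojD : {morph qproj : u v / u + v}.
Proof. by move=> u v; rewrite /qproj [LHS]raddfD. Qed.

Definition qscale (a : K) (q : Q) : Q := qproj (a *: repr q).

Lemma qscaleE a u : qscale a (qproj u) = qproj (a *: u).
Proof. by apply/qproj_eq; rewrite -scalerBr rpredZ ?qproj_repr. Qed.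

Lemma qscaleA a b q : qscale a (qscale b q) = qscale (a * b) q.
Proof. by rewrite -[q]qprojK !qscaleE scalerA. Qed.
Lemma qscale1 : left_id 1 qscale.
Proof. by move=> q; rewrite -[q]qprojK qscaleE scale1r. Qed.
Lemma qscaleDr : right_distributive qscale +%R.
Proof.
by move=> a p q; rewrite -[p]qprojK -[q]qprojK -qprojD !qscaleE scalerDr qprojD.
Qed.
Lemma qscaleDl q : {morph qscale^~ q : a b / a + b}.
Proof. by move=> a b; rewrite -[q]qprojK !qscaleE scalerDl qprojD. Qed.

HB.instance Definition _ :=
  GRing.Zmodule_isLmodule.Build K Q qscaleA qscale1 qscaleDr qscaleDl.

Lemma qproj_linear : linear qproj.
Proof. by move=> a u v; rewrite qprojD -qscaleE. Qed.
HB.instance Definition _ := GRing.isLinear.Build K V Q *:%R qproj qproj_linear.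

Lemma qproj0 u : (qproj u = 0) <-> u \in S.
Proof. by rewrite -(linear0 qproj) qproj_eq subr0. Qed.

End QuotientSpace.

(* The tensor product of vector spaces, as the quotient of the free space on  *)
(* V * W by the bilinearity relations.                                        *)
Section TensorSpace.
Variables (K : fieldType) (V W : lmodType K).
Local Notation free := {malg K[(V * W)%type]}.

Inductive tensor_rel : free -> Prop :=
| Tensor_rel_l a v v' w :
    tensor_rel (<< (a *: v + v', w) >> - (a *: << (v, w) >> + << (v', w) >>))
| Tensor_rel_r a v w w' :
    tensor_rel (<< (v, a *: w + w') >> - (a *: << (v, w) >> + << (v, w') >>)).

Definition tensor_space : Type := quotient_sort (span tensor_rel).
HB.instance Definition _ := GRing.Lmodule.on tensor_space.

Definition tprod (v : V) (w : W) : tensor_space := qproj _ << (v, w) >>.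

Lemma tprod_linearl w : linear (tprod^~ w).
Proof.
move=> a v v'; rewrite /tprod -linearP; apply/qproj_eq/mem_span.
exact: Tensor_rel_l.
Qed.
Lemma tprod_linearr v : linear (tprod v).
Proof.
move=> a w w'; rewrite /tprod -linearP; apply/qproj_eq/mem_span.
exact: Tensor_rel_r.
Qed.

Lemma tensor_ind (P : tensor_space -> Prop) :
  P 0 -> (forall a v w t, P t -> P (a *: tprod v w + t)) -> forall t, P t.
Proof.
move=> P0 PD t; rewrite -[t]qprojK; elim/malg_ind_lin: (repr t) => [|a [v w] u].
  by rewrite linear0.
by rewrite linearP; apply: PD.
Qed.

Section Lift.
Variables (U : lmodType K) (f : V -> W -> U).
Hypotheses (f_linearl : forall w, linear (f^~ w))
  (f_linearr : forall v, linear (f v)).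

Let F : free -> U := lext (fun p : V * W => f p.1 p.2).
Let FP a u v : F (a *: u + v) = a *: F u + F v.
Proof. exact: lext_linear. Qed.
Let FB u v : F (u - v) = F u - F v.
Proof. exact: linearB. Qed.
Let FU v w : F << (v, w) >> = f v w.
Proof. exact: lextU. Qed.

Lemma tensor_lift_ker u : u \in span tensor_rel -> F u = 0.
Proof.
have kcl : submod_closed (fun u => F u == 0).
  split=> [|a x y /eqP Fx /eqP Fy]; apply/eqP; first exact: linear0.
  by rewrite FP Fx Fy scaler0 addr0.
pose S := Subspace kcl; move=> uS; apply/eqP.
apply: (@span_sub _ _ tensor_rel S) uS => x [] a *; apply/eqP.
  by rewrite FB FP !FU f_linearl subrr.
by rewrite FB FP !FU f_linearr subrr.
Qed.

Definition tensor_lift (t : tensor_space) : U := F (repr t).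

Lemma tensor_liftE u : tensor_lift (qproj _ u) = F u.
Proof.
apply/eqP; rewrite -subr_eq0 /tensor_lift -FB.
by rewrite tensor_lift_ker // qproj_repr.
Qed.

Lemma tensor_lift_linear : linear tensor_lift.
Proof.
move=> a s t; rewrite -[s]qprojK -[t]qprojK -linearP !tensor_liftE.
exact: FP.
Qed.

Lemma tensor_lift_tprod v w : tensor_lift (tprod v w) = f v w.
Proof. by rewrite tensor_liftE FU. Qed.

End Lift.
End TensorSpace.

Record lieAlgebra (K : fieldType) := LieAlgebra {
  lie_space :> lmodType K;
  bracket : lie_space -> lie_space -> lie_space;
  bracket_linearl : forall y, linear (bracket^~ y);
  bracket_linearr : forall x, linear (bracket x);
  bracketxx : forall x, bracket x x = 0;
  jacobi : forall x y z, bracket x (bracket y z) + bracket y (bracket z x)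
                         + bracket z (bracket x y) = 0 }.

Record lieModule (K : fieldType) (g : lieAlgebra K) := LieModule {
  mod_space :> lmodType K;
  act : g -> mod_space -> mod_space;
  act_linearl : forall u, linear (act^~ u);
  act_linearr : forall x, linear (act x);
  act_bracket : forall x y u,
    act (bracket x y) u = act x (act y u) - act y (act x u) }.

Section LieModules.
Variables (K : fieldType) (g : lieAlgebra K).
Implicit Types M N : lieModule g.

Definition act_stable M (S : subspace M) :=
  forall x u, u \in S -> act x u \in S.

Definition module_hom M N (f : {linear M -> N}) :=
  forall x u, f (act x u) = act x (f u).

Definition irreducible M :=
  (exists u : M, u != 0) /\
  (forall S : subspace M, act_stable S ->
     (forall u, u \in S -> u = 0) \/ (forall u, u \in S)).

Definition cyclic_on M (w : M) :=
  forall S : subspace M, act_stable S -> w \in S -> forall u, u \in S.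

Section Submodule.
Variables (M : lieModule g) (S : subspace M) (stS : act_stable S).

Definition sub_act (x : g) (u : subspace_sort S) : subspace_sort S :=
  exist _ (act x (val u)) (stS x (valP u)).

Lemma sub_act_linearl u : linear (sub_act^~ u).
Proof. by move=> a x y; apply/val_inj; rewrite /= act_linearl. Qed.
Lemma sub_act_linearr x : linear (sub_act x).
Proof. by move=> a u v; apply/val_inj; rewrite /= act_linearr. Qed.
Lemma sub_act_bracket x y u :
  sub_act (bracket x y) u = sub_act x (sub_act y u) - sub_act y (sub_act x u).
Proof. by apply/val_inj; rewrite /= act_bracket. Qed.

Definition submodule : lieModule g :=
  LieModule sub_act_linearl sub_act_linearr sub_act_bracket.

Definition quot_act (x : g) (q : quotient_sort S) : quotient_sort S :=
  qproj S (act x (repr q)).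

Lemma quot_actE x u : quot_act x (qproj S u) = qproj S (act x u).
Proof. by apply/qproj_eq; rewrite -(linear_funB (act_linearr x)) stS ?qproj_repr. Qed.

Lemma quot_act_linearl q : linear (quot_act^~ q).
Proof. by move=> a x y; rewrite -[q]qprojK !quot_actE act_linearl linearP. Qed.
Lemma quot_act_linearr x : linear (quot_act x).
Proof.
move=> a p q; rewrite -[p]qprojK -[q]qprojK -linearP !quot_actE.
by rewrite act_linearr linearP.
Qed.
Lemma quot_act_bracket x y q : quot_act (bracket x y) q =
  quot_act x (quot_act y q) - quot_act y (quot_act x q).
Proof. by rewrite -[q]qprojK !quot_actE act_bracket linearB. Qed.

Definition quotient : lieModule g :=
  LieModule quot_act_linearl quot_act_linearr quot_act_bracket.

End Submodule.

Section Tensor.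
Variables M N : lieModule g.

Let act2 (x : g) (v : M) (w : N) := tprod (act x v) w + tprod v (act x w).

Fact act2_linearl x w : linear (act2 x ^~ w).
Proof.
move=> a u v; rewrite /act2 act_linearr !tprod_linearl scalerDr.
by rewrite addrACA.
Qed.
Fact act2_linearr x v : linear (act2 x v).
Proof.
move=> a u w; rewrite /act2 act_linearr !tprod_linearr scalerDr.
by rewrite addrACA.
Qed.

Definition tensor_act (x : g) : tensor_space M N -> tensor_space M N :=
  tensor_lift (fun v w => tprod (act x v) w + tprod v (act x w)).

Lemma tensor_actE x v w :
  tensor_act x (tprod v w) = tprod (act x v) w + tprod v (act x w).
Proof. exact: (tensor_lift_tprod (act2_linearl x) (act2_linearr x)). Qed.

Lemma tensor_act_linearr x : linear (tensor_act x).
Proof. exact: (tensor_lift_linear (act2_linearl x) (act2_linearr x)). Qed.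

Lemma tensor_act0 x : tensor_act x 0 = 0.
Proof. exact: (linear_fun0 (tensor_act_linearr x)). Qed.

Lemma tensor_act_linearl t : linear (tensor_act^~ t).
Proof.
move=> a x y; elim/tensor_ind: t => [|b v w t IH].
  by rewrite !tensor_act0 scaler0 addr0.
rewrite !tensor_act_linearr IH !tensor_actE !act_linearl.
rewrite tprod_linearl tprod_linearr.
exact: comb_swap.
Qed.

Lemma tensor_act_bracket x y t : tensor_act (bracket x y) t =
  tensor_act x (tensor_act y t) - tensor_act y (tensor_act x t).
Proof.
have actD z := linear_funD (tensor_act_linearr z).
have tBl w := linear_funB (@tprod_linearl _ M N w).
have tBr v := linear_funB (@tprod_linearr _ M N v).
elim/tensor_ind: t => [|b v w t IH].
  by rewrite !tensor_act0 subrr.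
rewrite 5!tensor_act_linearr; refine (comb_sub _ _ IH) => {t IH}.
rewrite !tensor_actE !actD !tensor_actE !act_bracket tBl tBr.
exact: shuffle8.
Qed.

Definition tensor : lieModule g :=
  LieModule tensor_act_linearl tensor_act_linearr tensor_act_bracket.

Definition pure_tensor (v : M) (w : N) : tensor := tprod v w.

Lemma act_pure_tensor x v w :
  act x (pure_tensor v w) = pure_tensor (act x v) w + pure_tensor v (act x w).
Proof. exact: tensor_actE. Qed.

End Tensor.

Lemma act_stable_span M (A : M -> Prop) :
  (forall x a, A a -> act x a \in span A) -> act_stable (span A).
Proof.
move=> stA x u uA.
have cl : submod_closed (fun u : M => act x u \in span A).
  split=> [|a v w Sv Sw]; rewrite unfold_in.
    by rewrite (linear_fun0 (act_linearr x)) rpred0.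
  by rewrite act_linearr rpredD ?rpredZ.
exact: (@span_sub _ _ A (Subspace cl)) (stA x) _ uA.
Qed.

End LieModules.

Section Virasoro.
Variable K : fieldType.
Local Notation virT := {malg K[option int]}.

(* The basis of Vir is indexed by [option int]: [Some n] stands for L_n and   *)
(* [None] for C.                                                              *)
Definition vir_basis_bracket (i j : option int) : virT :=
  match i, j with
  | Some n, Some m => (n - m)%:~R *: << Some (m + n) >>
      + ((m == - n)%:R * ((n ^+ 3 - n)%:~R / 12%:R)) *: << None >>
  | _, _ => 0
  end.

Definition vir_bracket (x y : virT) : virT :=
  lext (fun i => lext (vir_basis_bracket i) y) x.

Lemma vir_bracket_linearl y : linear (vir_bracket^~ y).
Proof. by move=> a x x'; exact: linearP. Qed.

Lemma vir_bracket_linearr x : linear (vir_bracket x).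
Proof.
move=> a y y'; rewrite /vir_bracket -lext_comb; apply: eq_lext => i.
exact: linearP.
Qed.

Lemma vir_bracket0l y : vir_bracket 0 y = 0. Proof. exact: linear0. Qed.
Lemma vir_bracket0r x : vir_bracket x 0 = 0.
Proof. exact: (linear_fun0 (vir_bracket_linearr x)). Qed.

Lemma vir_bracketU i j :
  vir_bracket << i >> << j >> = vir_basis_bracket i j.
Proof. by rewrite /vir_bracket !lextU. Qed.

Let brZr x a y : vir_bracket x (a *: y) = a *: vir_bracket x y.
Proof. exact: (linear_funZ (vir_bracket_linearr x)). Qed.

Let brNl y : vir_bracket << None >> y = 0.
Proof.
elim/malg_ind_lin: y => [|a j y IH]; first exact: vir_bracket0r.
by rewrite vir_bracket_linearr vir_bracketU IH scaler0 addr0.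
Qed.

Lemma vir_basis_bracketxx i : vir_basis_bracket i i = 0.
Proof.
case: i => //= n; rewrite subrr scale0r add0r.
have [n0|] := eqVneq n (- n); last by rewrite mul0r scale0r.
have -> : n = 0 by lia.
by rewrite expr0n subrr mul0r mulr0 scale0r.
Qed.

Lemma vir_basis_bracketC i j :
  vir_basis_bracket i j + vir_basis_bracket j i = 0.
Proof.
case: i j => [n|] [m|] //=; rewrite ?addr0 //.
rewrite (_ : Some (n + m) = Some (m + n)); last by rewrite addrC.
rewrite comb_add -intrD (_ : n - m + (m - n) = 0); last by ring.
rewrite scale0r add0r (_ : (n == - m) = (m == - n)); last by apply/eqP/eqP; lia.
have [->|_] := eqVneq m (- n); last by rewrite !mul0r addr0 scale0r.
rewrite !mul1r -mulrDl -intrD (_ : _ + _ = 0 :> int) ?mul0r ?scale0r //.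
by ring.
Qed.

Lemma vir_bracketC x y : vir_bracket x y + vir_bracket y x = 0.
Proof.
elim/malg_ind_lin: x => [|a i x IH]; first by rewrite vir_bracket0l vir_bracket0r addr0.
rewrite vir_bracket_linearl vir_bracket_linearr; refine (comb_eq0 _ _ IH).
elim/malg_ind_lin: y {IH} => [|b j y IH]; first by rewrite vir_bracket0l vir_bracket0r addr0.
rewrite vir_bracket_linearl vir_bracket_linearr; refine (comb_eq0 _ _ IH).
by rewrite !vir_bracketU vir_basis_bracketC.
Qed.

Lemma vir_bracketxx x : vir_bracket x x = 0.
Proof.
elim/malg_ind_lin: x => [|a i x IH]; first by rewrite vir_bracket0l.
rewrite vir_bracket_linearl !vir_bracket_linearr IH.
rewrite vir_bracketU vir_basis_bracketxx scaler0 add0r.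
rewrite addr0; refine (etrans (esym (scalerDr _ _ _)) _).
by rewrite vir_bracketC scaler0.
Qed.

Let jac x y z := vir_bracket x (vir_bracket y z)
  + vir_bracket y (vir_bracket z x) + vir_bracket z (vir_bracket x y).

Let jac_linear a x x' y z :
  jac (a *: x + x') y z = a *: jac x y z + jac x' y z.
Proof.
rewrite /jac vir_bracket_linearl (vir_bracket_linearr z) vir_bracket_linearr.
by rewrite vir_bracket_linearl vir_bracket_linearr comb3.
Qed.

Let jac_rot x y z : jac x y z = jac y z x.
Proof. by rewrite /jac -addrA addrC. Qed.

Lemma vir_bracket_basis2 (n m p : int) :
  vir_bracket << Some n >> (vir_basis_bracket (Some m) (Some p)) =
  ((m - p)%:~R * (n - m - p)%:~R) *: << Some (n + m + p) >> +
  ((n + m + p == 0)%:R * ((m - p)%:~R * ((n ^+ 3 - n)%:~R / 12%:R)))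
    *: << None >>.
Proof.
rewrite vir_bracket_linearr brZr !vir_bracketU /= scaler0 addr0.
rewrite scalerDr !scalerA mulrCA (_ : Some (p + m + n) = Some (n + m + p)).
  rewrite (_ : n - (p + m) = n - m - p); last by ring.
  by rewrite (_ : (p + m == - n) = (n + m + p == 0)) //; apply/eqP/eqP; lia.
by congr Some; ring.
Qed.

Let comb_add3 (V : lmodType K) (a b c a' b' c' : K) (u v : V) :
  a + b + c = 0 -> a' + b' + c' = 0 ->
  (a *: u + a' *: v) + (b *: u + b' *: v) + (c *: u + c' *: v) = 0.
Proof. by move=> e e'; rewrite !comb_add e e' !scale0r addr0. Qed.

Lemma vir_jacobi_basis i j k : jac << i >> << j >> << k >> = 0.
Proof.
rewrite /jac !vir_bracketU.
case: i j k => [n|] [m|] [p|]; rewrite ?(vir_bracket0r, addr0, add0r) ?brNl //.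
rewrite !vir_bracket_basis2.
rewrite (_ : Some (m + p + n) = Some (n + m + p)); last by congr Some; ring.
rewrite (_ : Some (p + n + m) = Some (n + m + p)); last by congr Some; ring.
rewrite (_ : m + p + n = n + m + p); last by ring.
rewrite (_ : p + n + m = n + m + p); last by ring.
refine (comb_add3 _ _ _ _); first by ring.
have [nmp|_] := eqVneq (n + m + p) 0; last by rewrite !mul0r !addr0.
have -> : p = - (n + m) by lia.
by move: (12%:R^-1) => t; ring.
Qed.

Let jac_ind y z : (forall i, jac << i >> y z = 0) -> forall x, jac x y z = 0.
Proof.
move=> J0; elim/malg_ind_lin => [|a i x IH].
  by rewrite /jac !(vir_bracket0l, vir_bracket0r) !addr0.
by rewrite jac_linear IH J0 scaler0 addr0.
Qed.

Lemma vir_jacobi x y z : jac x y z = 0.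
Proof.
apply: jac_ind => i; rewrite jac_rot; apply: jac_ind => j; rewrite jac_rot.
by apply: jac_ind => k; exact: vir_jacobi_basis.
Qed.

Definition Vir : lieAlgebra K :=
  LieAlgebra vir_bracket_linearl vir_bracket_linearr vir_bracketxx vir_jacobi.

Definition virL (n : int) : Vir := << Some n >>.
Definition virC : Vir := << None >>.

End Virasoro.

Section VirasoroModules.
Variable K : fieldType.
Local Notation Vir := (Vir K).

Section HighestWeight.
Variables c h : K.

Definition highest_weight_vector (M : lieModule Vir) (v : M) :=
  [/\ act (virC K) v = c *: v, act (virL K 0) v = h *: v
    & forall n : int, 0 < n -> act (virL K n) v = 0].

(* (V, v) has the universal property of the Verma module V(c, h). *)
Definition is_Verma (V : lieModule Vir) (v : V) :=
  [/\ highest_weight_vector v, cyclic_on v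
    & forall (N : lieModule Vir) (w : N), highest_weight_vector w ->
        exists2 f : {linear V -> N}, module_hom f & f v = w].

(* (L, v) is the irreducible quotient L(c, h) of V(c, h), with v the image of *)
(* the generator.                                                             *)
Definition is_irreducible_Verma_quotient (L : lieModule Vir) (v : L) :=
  irreducible L /\
  exists (V : lieModule Vir) (w : V) (p : {linear V -> L}),
    [/\ is_Verma w, module_hom p, (forall u, exists x, p x = u) & p w = v].

End HighestWeight.

Section IntermediateSeries.
Variables alpha beta : K.
Local Notation vabT := {malg K[int]}.

Definition vab_op (i : option int) : vabT -> vabT :=
  match i with
  | Some n => lext (fun m : int =>
      (- (m%:~R + alpha + beta + n%:~R * beta)) *: << m + n >>)
  | None => fun=> 0
  end.

Definition vab_act (x : Vir) (u : vabT) : vabT := lext (vab_op^~ u) x.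

Let vab_op_linear i : linear (vab_op i).
Proof.
by case: i => [n|] a u v; [exact: lext_linear | rewrite /= scaler0 addr0].
Qed.

Lemma vab_act_linearl u : linear (vab_act^~ u).
Proof. by move=> a x y; exact: lext_linear. Qed.

Lemma vab_act_linearr x : linear (vab_act x).
Proof.
move=> a u v; rewrite /vab_act -lext_comb; apply: eq_lext => i.
exact: vab_op_linear.
Qed.

Lemma vab_actU i u : vab_act << i >> u = vab_op i u.
Proof. by rewrite /vab_act lextU. Qed.

Lemma vab_actUU n m : vab_act << Some n >> << m >> =
  (- (m%:~R + alpha + beta + n%:~R * beta)) *: << m + n >>.
Proof. by rewrite vab_actU /= lextU. Qed.

Let vab_act0l u : vab_act 0 u = 0. Proof. exact: linear0. Qed.
Let vab_act0r x : vab_act x 0 = 0.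
Proof. exact: (linear_fun0 (vab_act_linearr x)). Qed.
Let vab_actZr x a u : vab_act x (a *: u) = a *: vab_act x u.
Proof. exact: (linear_funZ (vab_act_linearr x)). Qed.
Let vab_actZl x a u : vab_act (a *: x) u = a *: vab_act x u.
Proof. exact: (linear_funZ (vab_act_linearl u)). Qed.

Let vab_act_bracket_basis i j m :
  vab_act (vir_basis_bracket K i j) << m >> =
  vab_act << i >> (vab_act << j >> << m >>) -
  vab_act << j >> (vab_act << i >> << m >>).
Proof.
case: i j => [n|] [p|].
- rewrite /= vab_act_linearl vab_actZl (vab_actU None) /= scaler0 addr0.
  rewrite !vab_actUU !vab_actZr !vab_actUU !scalerA.
  rewrite (_ : m + n + p = m + p + n); last by ring.
  rewrite (_ : m + (p + n) = m + p + n); last by ring.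
  by refine (etrans _ (scalerBl _ _ _)); congr (_ *: _); ring.
- by rewrite vab_act0l !vab_actU /= linear0 subr0.
- by rewrite vab_act0l !vab_actU /= linear0 subr0.
- by rewrite vab_act0l !vab_actU subrr.
Qed.

Lemma vab_act_bracket x y u : vab_act (vir_bracket x y) u =
  vab_act x (vab_act y u) - vab_act y (vab_act x u).
Proof.
elim/malg_ind_lin: u => [|a m u IHu]; first by rewrite !vab_act0r subrr.
rewrite 5!vab_act_linearr; refine (comb_sub _ _ IHu) => {u IHu}.
elim/malg_ind_lin: x => [|a' i x IHx].
  by rewrite vir_bracket0l !vab_act0l !vab_act0r subrr.
rewrite vir_bracket_linearl 3!vab_act_linearl vab_act_linearr.
refine (comb_sub _ _ IHx) => {x IHx}.
elim/malg_ind_lin: y => [|b j y IHy].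
  by rewrite vir_bracket0r !vab_act0l !vab_act0r subrr.
rewrite vir_bracket_linearr 3!vab_act_linearl vab_act_linearr.
refine (comb_sub _ _ IHy).
by rewrite vir_bracketU vab_act_bracket_basis.
Qed.

Definition Vab : lieModule Vir :=
  LieModule vab_act_linearl vab_act_linearr vab_act_bracket.

End IntermediateSeries.

Definition vab (alpha beta : K) (m : int) : Vab alpha beta := << m >>.

Lemma act_virL_vab alpha beta n m : act (virL K n) (vab alpha beta m) =
  (- (m%:~R + alpha + beta + n%:~R * beta)) *: vab alpha beta (m + n).
Proof. exact: vab_actUU. Qed.

Lemma act_virC_vab alpha beta m : act (virC K) (vab alpha beta m) = 0.
Proof. exact: vab_actU. Qed.

Lemma vir_stable_span (M : lieModule Vir) (A : M -> Prop) :
  (forall u, A u -> act (virC K) u \in span A) ->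
  (forall n u, A u -> act (virL K n) u \in span A) -> act_stable (span A).
Proof.
move=> AC AL; apply: act_stable_span => x u Au.
elim/malg_ind_lin: x => [|a i x IH].
  by rewrite (linear_fun0 (act_linearl u)) rpred0.
by rewrite act_linearl rpredD ?rpredZ //; case: i => [n|]; [apply: AL|apply: AC].
Qed.

Definition line_v0 : subspace (Vab 0 0) := span (fun u => u = vab 0 0 0).

Lemma line_v0_stable : act_stable line_v0.
Proof.
apply: vir_stable_span => [|n] _ ->; first by rewrite act_virC_vab rpred0.
by rewrite act_virL_vab mulr0 !addr0 oppr0 scale0r rpred0.
Qed.

Definition span_neqN1 : subspace (Vab 0 1) :=
  span (fun u => exists2 m : int, m != -1 & u = vab 0 1 m).

Lemma span_neqN1_stable : act_stable span_neqN1.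
Proof.
apply: vir_stable_span => [|n] _ [m mN1 ->].
  by rewrite act_virC_vab rpred0.
rewrite act_virL_vab; have [mn|mn] := eqVneq (m + n) (-1); last first.
  by apply/rpredZ/mem_span; exists (m + n).
have -> : n = -1 - m by lia.
by rewrite (_ : - _ = 0) ?scale0r ?rpred0 //; ring.
Qed.

(* alpha is taken to be 0 whenever it is an integer. *)
Definition normalize (alpha : K) : K :=
  if `[< exists k : int, alpha = k%:~R >] then 0 else alpha.

Variant vab_case := Case00 | Case01 | Case_generic.

Definition vab_case_of (alpha beta : K) : vab_case :=
  if (alpha == 0) && (beta == 0) then Case00
  else if (alpha == 0) && (beta == 1) then Case01 else Case_generic.

Definition Vprime_case (alpha beta : K) (s : vab_case) : lieModule Vir :=
  match s with
  | Case00 => quotient line_v0_stable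
  | Case01 => submodule span_neqN1_stable
  | Case_generic => Vab alpha beta
  end.

(* The image of v_0 in [Case00] is 0, and so is the value of [insubd] at the  *)
(* missing v_{-1} in [Case01]; [vprime_index] excludes these two indices.     *)
Definition vprime_case (alpha beta : K) (s : vab_case) (m : int) :
    Vprime_case alpha beta s :=
  match s with
  | Case00 => qproj line_v0 (vab 0 0 m)
  | Case01 => insubd (0 : subspace_sort span_neqN1) (vab 0 1 m)
  | Case_generic => vab alpha beta m
  end.

Lemma val_vprime_case01 alpha beta m : m != -1 ->
  val (vprime_case alpha beta Case01 m) = vab 0 1 m.
Proof. by move=> mN1; apply/insubdK/mem_span; exists m. Qed.

Definition Vprime (alpha beta : K) : lieModule Vir :=
  Vprime_case (normalize alpha) beta (vab_case_of (normalize alpha) beta).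

Definition vprime (alpha beta : K) (m : int) : Vprime alpha beta :=
  vprime_case (normalize alpha) beta (vab_case_of (normalize alpha) beta) m.

Definition vprime_index (alpha beta : K) (m : int) : bool :=
  match vab_case_of (normalize alpha) beta with
  | Case00 => m != 0
  | Case01 => m != -1
  | Case_generic => true
  end.

End VirasoroModules.

(* Main.v *)
(* The hard direction rests on the fact that every nonzero submodule U of
   M (x) L contains v_m (x) v for all large m. Write a nonzero element of U as a
   finite sum of v_i (x) y_i with distinct indices i. Since L_k y_i = 0 for k
   large, L_k and L_j L_k act on it through the first factor only: suitable
   combinations put the sum of the v_{i+N} (x) z_i in U for all large N, where
   z_i is a nonzero multiple of y_i (for beta = 1, after rescaling the v_m). One
   more L_k multiplies each z_i by i - x for any scalar x, so killing all indices
   but one isolates v_N (x) z_i. Finally, the y in L such that v_N (x) y is in U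
   for all large N form a nonzero submodule of L, hence all of L. *)

Require Import Defs.
From mathcomp Require Import all_boot all_order all_algebra.
From mathcomp Require Import complex reals.
From mathcomp Require Import boolp monalg ring zify.
Import GRing.Theory Num.Theory.
Local Open Scope ring_scope.

(** * Virasoro relations as operator identities on a module *)

Section ActionOnBasis.
Variables (K : fieldType) (M : lieModule (Vir K)).
Implicit Types (u w : M) (S : subspace M).

Lemma actD x u w : act x (u + w) = act x u + act x w.
Proof. exact: linear_funD (act_linearr x) u w. Qed.

Lemma actZ x a u : act x (a *: u) = a *: act x u.
Proof. exact: linear_funZ (act_linearr x) a u. Qed.

Lemma act0r x : act x (0 : M) = 0.
Proof. exact: linear_fun0 (act_linearr x). Qed.

Lemma act_sum x (I : Type) (s : seq I) (F : I -> M) :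
  act x (\sum_(i <- s) F i) = \sum_(i <- s) act x (F i).
Proof.
elim: s => [|i s IH]; first by rewrite !big_nil act0r.
by rewrite !big_cons actD IH.
Qed.

Lemma vir_stable S :
  (forall u, u \in S -> act (virC K) u \in S) ->
  (forall n u, u \in S -> act (virL K n) u \in S) -> act_stable S.
Proof.
move=> SC SL x u Su; elim/malg_ind_lin: x => [|a [n|] x IH].
- by rewrite (linear_fun0 (act_linearl u)) rpred0.
- by rewrite act_linearl rpredD ?rpredZ //; apply: SL.
- by rewrite act_linearl rpredD ?rpredZ //; apply: SC.
Qed.

Lemma act_virL_virL n m u : act (virL K n) (act (virL K m) u) =
  act (virL K m) (act (virL K n) u) + (n - m)%:~R *: act (virL K (m + n)) u
  + ((m == - n)%:R * ((n ^+ 3 - n)%:~R / 12%:R)) *: act (virC K) u.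
Proof.
have /eqP := act_bracket (virL K n) (virL K m) u.
rewrite -subr_eq0 opprB addrA subr_eq0 => /eqP <-.
by rewrite addrC -addrA /= vir_bracketU /= act_linearl
  (linear_funZ (act_linearl u)).
Qed.

Lemma act_virL_virC n u :
  act (virL K n) (act (virC K) u) = act (virC K) (act (virL K n) u).
Proof.
have /eqP := act_bracket (virL K n) (virC K) u.
by rewrite /= vir_bracketU /= (linear_fun0 (act_linearl u)) eq_sym subr_eq0
  => /eqP.
Qed.

End ActionOnBasis.

(** * Bilinearity and nonvanishing of pure tensors *)

Section Tensors.
Variables (K : fieldType) (g : lieAlgebra K) (M N : lieModule g).

Lemma pure_tensorDr u : {morph @pure_tensor K g M N u : x y / x + y}.
Proof. exact: linear_funD (@tprod_linearr K M N u). Qed.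

Lemma pure_tensorZr u a x : pure_tensor u (a *: x : N) = a *: pure_tensor (u : M) x.
Proof. exact: linear_funZ (@tprod_linearr K M N u) a x. Qed.

Lemma pure_tensorZl u a x : pure_tensor (a *: u : M) (x : N) = a *: pure_tensor u x.
Proof. exact: linear_funZ (@tprod_linearl K M N x) a u. Qed.

Lemma pure_tensor0r u : pure_tensor (u : M) (0 : N) = 0.
Proof. exact: linear_fun0 (@tprod_linearr K M N u). Qed.

Lemma pure_tensor0l x : pure_tensor (0 : M) (x : N) = 0.
Proof. exact: linear_fun0 (@tprod_linearl K M N x). Qed.

(** The functional [f] induces a linear map from the tensor product to [N], which sends this tensor
    to [f u *: x]. *)
Lemma pure_tensor_neq0 (f : M -> K) u x : linear (f : M -> K^o) ->
  f u != 0 -> x != 0 -> pure_tensor (u : M) (x : N) != 0.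
Proof.
move=> f_lin fu x0; apply/eqP => ux0.
pose F (u' : M) (x' : N) : N := f u' *: x'.
have Fl x' : linear (F^~ x').
  by move=> a p q; rewrite /F (f_lin a p q) scalerDl scalerA.
have Fr u' : linear (F u').
  by move=> a p q; rewrite /F scalerDr !scalerA mulrC.
have := tensor_lift_tprod Fl Fr u x; rewrite -/(pure_tensor u x) ux0.
rewrite (linear_fun0 (tensor_lift_linear Fl Fr)) => /esym/eqP.
by rewrite scaler_eq0 (negPf fu) (negPf x0).
Qed.

End Tensors.

(** * Properties of all large integers *)

Definition ultimately (P : int -> Prop) :=
  exists N0 : int, forall N, N0 <= N -> P N.

Lemma ultimately_and (P Q : int -> Prop) :
  ultimately P -> ultimately Q -> ultimately (fun N => P N /\ Q N).
Proof.
move=> [p Pp] [q Qq]; exists (Order.max p q) => N pqN.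
by split; [apply: Pp|apply: Qq]; lia.
Qed.

Lemma ultimately_all (s : seq int) (P : int -> int -> Prop) :
  (forall i, ultimately (P i)) ->
  ultimately (fun N => forall i, i \in s -> P i N).
Proof.
move=> Pu; elim: s => [|i s IH]; first by exists 0.
have [N0 IN] := ultimately_and _ _ (Pu i) IH; exists N0 => N /IN [Pi Ps] j.
by rewrite inE => /orP[/eqP->|/Ps].
Qed.

Lemma ultimately_shift (P : int -> Prop) k :
  ultimately P -> ultimately (fun N => P (N + k)).
Proof. by move=> [p Pp]; exists (p - k) => N pN; apply: Pp; lia. Qed.

Lemma ultimately_imp (P Q : int -> Prop) : (forall N, P N -> Q N) ->
  ultimately P -> ultimately Q.
Proof. by move=> PQ [p Pp]; exists p => N /Pp /PQ. Qed.

(** * The irreducible highest weight module L(c,h) *)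

Section HighestWeight.
Variables (K : fieldType) (c h : K) (L : lieModule (Vir K)) (v : L).
Hypothesis hL : is_irreducible_Verma_quotient c h v.

(** Otherwise the kernel of the surjection [p] is a submodule containing the generator of the Verma
    module, so [p] and hence [L] would be zero. *)
Lemma Verma_quotient_neq0 : v != 0.
Proof.
have [[[u0 u0N] _] [V [w [p [[_ Vcyc _] ph psurj pw]]]]] := hL.
have cl : submod_closed (fun x : V => p x == 0).
  split=> [|a x y /eqP px /eqP py]; rewrite unfold_in; first by rewrite linear0.
  by rewrite linearP px py scaler0 addr0.
apply/eqP => v0; have [x px] := psurj u0.
suff : x \in Subspace cl by rewrite unfold_in px (negPf u0N).
apply: Vcyc => [y z|]; rewrite !unfold_in; last by rewrite pw v0.
by rewrite ph => /eqP ->; rewrite act0r.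
Qed.

(** The vectors with this property form a submodule that contains [v]; since [v] is nonzero,
    irreducibility makes it all of [L]. *)
Lemma Verma_quotient_restricted (y : L) :
  ultimately (fun k => act (virL K k) y = 0).
Proof.
have [[_ Lirr] [V [w [p [[[_ _ wL] _ _] ph _ pw]]]]] := hL.
have cl : submod_closed
    (fun y : L => `[< ultimately (fun k => act (virL K k) y = 0) >]).
  split=> [|a x z /asboolP xU /asboolP zU]; apply/asboolP.
    by exists 0 => k _; rewrite act0r.
  apply: ultimately_imp (ultimately_and _ _ xU zU) => k [xk zk].
  by rewrite act_linearr xk zk scaler0 addr0.
have st : act_stable (Subspace cl).
  apply: vir_stable => [|n] x /asboolP xU; apply/asboolP.
    by apply: ultimately_imp xU => k xk; rewrite act_virL_virC xk act0r.
  (* For such [k] the commutator of L_k and L_n has no central term. *)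
  have gt : ultimately (fun k => - n < k) by exists (1 - n) => k; lia.
  apply: ultimately_imp
    (ultimately_and _ _ gt (ultimately_and _ _ xU (ultimately_shift _ n xU))).
  move=> k [kn [xk xkn]].
  rewrite act_virL_virL xk act0r [n + k]addrC xkn scaler0 !add0r.
  by rewrite (_ : n == - k = false) ?mul0r ?scale0r //; apply/eqP; lia.
have [S0|/(_ y)/asboolP //] := Lirr _ st.
suff /S0 v0 : v \in Subspace cl by move: Verma_quotient_neq0; rewrite v0 eqxx.
by apply/asboolP; exists 1 => k k1; rewrite -pw -ph wL ?linear0 //; lia.
Qed.

End HighestWeight.

(** * Submodules of M (x) L, for M spanned by weight vectors *)

Section WeightBasis.
Variables (K : numFieldType) (a b : K) (M : lieModule (Vir K)) (e : int -> M).
Hypothesis b1 : b != 1.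
Hypothesis e_act : forall n m, act (virL K n) (e m) =
  (- (m%:~R + a + b + n%:~R * b)) *: e (m + n).
Hypothesis e_actC : forall m, act (virC K) (e m) = 0.
Hypothesis e_span : forall u : M, u \in Defs.span (fun x => exists m, x = e m).
(** For [b = 0] every L_n multiplies [e m] by -(m + a) besides shifting it; this ensures that no
    nonzero [e m] is annihilated by that factor. *)
Hypothesis e_b0 : b = 0 -> forall m, m%:~R + a = 0 -> e m = 0.

Variable L : lieModule (Vir K).
Hypothesis L_restricted :
  forall y : L, ultimately (fun k => act (virL K k) y = 0).

Definition shifted_sum (s : seq int) (y : int -> L) (N : int) : tensor M L :=
  \sum_(i <- s) pure_tensor (e (i + N)) (y i).

Lemma weight_expansion (t : tensor M L) :
  exists s y, uniq s /\ t = \sum_(i <- s) pure_tensor (e i) (y i).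
Proof.
pose P (t : tensor M L) :=
  exists s y, uniq s /\ t = \sum_(i <- s) pure_tensor (e i) (y i).
have Pe m w t' : P t' -> P (pure_tensor (e m) w + t').
  move=> [s [y [us ->]]]; have [ms|mNs] := boolP (m \in s).
    exists s, (fun i => if i == m then w + y i else y i); split=> //.
    rewrite !(bigD1_seq m ms us) /= eqxx pure_tensorDr addrA; congr (_ + _).
    by apply: eq_bigr => i /negPf ->.
  exists (m :: s), (fun i => if i == m then w else y i).
  rewrite /= mNs us big_cons eqxx; split=> //; congr (_ + _).
  rewrite !big_seq; apply: eq_bigr => i is_; case: eqP => // im.
  by rewrite -im is_ in mNs.
(* [Pe] treats only the vectors [e m]; the [u] for which it holds form a subspace, so [e_span]
   extends it to all of [M]. *)
have cl : submod_closed (fun u : M =>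
    `[< forall w t', P t' -> P (pure_tensor u w + t') >]).
  split=> [|k x z /asboolP Px /asboolP Pz]; apply/asboolP => w t' Pt.
    by rewrite pure_tensor0l add0r.
  rewrite /pure_tensor tprod_linearl -addrA -/(pure_tensor x w).
  by rewrite -pure_tensorZr; apply/Px/Pz.
rewrite -/(P t); elim/tensor_ind: t => [|k u w t IH].
  by exists [::], (fun=> 0); rewrite big_nil.
have /(@span_sub _ _ _ (Subspace cl)) :
    forall x, (exists m, x = e m) -> x \in Subspace cl.
  by move=> x [m ->]; apply/asboolP => *; apply: Pe.
move=> /(_ u (e_span u)) /asboolP Pu.
by have := Pu (k *: w) t IH; rewrite pure_tensorZr.
Qed.

Lemma shifted_sum_comb k s y z N :
  shifted_sum s (fun i => k *: y i + z i) N
  = k *: shifted_sum s y N + shifted_sum s z N.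
Proof.
rewrite scaler_sumr -big_split; apply: eq_bigr => i _ /=.
by rewrite pure_tensorDr pure_tensorZr.
Qed.

Lemma shifted_sumZ k s y N :
  shifted_sum s (fun i => k *: y i) N = k *: shifted_sum s y N.
Proof. by rewrite scaler_sumr; apply: eq_bigr => i _; rewrite pure_tensorZr. Qed.

Lemma eq_shifted_sum s y z N : y =1 z -> shifted_sum s y N = shifted_sum s z N.
Proof. by move=> yz; apply: eq_bigr => i _; rewrite yz. Qed.

Lemma act_shifted_sum n s y N :
  (forall i, i \in s -> act (virL K n) (y i) = 0) ->
  act (virL K n) (shifted_sum s y N) =
  shifted_sum s (fun i => - ((i + N)%:~R + a + b + n%:~R * b) *: y i) (N + n).
Proof.
move=> yn; rewrite /shifted_sum act_sum; apply: eq_big_seq => i is_.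
by rewrite act_pure_tensor e_act yn // pure_tensor0r addr0 pure_tensorZl
  pure_tensorZr addrA.
Qed.

Lemma restricted_family (s : seq int) (y : int -> L) :
  ultimately (fun n => forall i, i \in s -> act (virL K n) (y i) = 0).
Proof. by apply: ultimately_all => i. Qed.

Variable U : subspace (tensor M L).
Hypothesis U_stable : act_stable U.

Lemma eq_shifted_sum_mem s y z N : y =1 z ->
  shifted_sum s y N \in U -> shifted_sum s z N \in U.
Proof. by move=> /eq_shifted_sum ->. Qed.

(** For a fixed large [n], L_n moves the sum at [N - n] to [N] and multiplies [y i] by a scalar that
    is affine in [i] with slope -1. A multiple of the sum already present at [N] corrects the
    constant. *)
Lemma shifted_sum_weight s y (k : K) :
  ultimately (fun N => shifted_sum s y N \in U) ->
  ultimately (fun N => shifted_sum s (fun i => (i%:~R - k) *: y i) N \in U).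
Proof.
move=> yU; have [n yn] := restricted_family s y.
apply: ultimately_imp (ultimately_and _ _ yU (ultimately_shift _ (- n) yU)).
move=> N [yN /(U_stable (virL K n))].
rewrite act_shifted_sum ?subrK; last exact: yn.
set z := (X in shifted_sum s X N) => zN.
pose d := N%:~R - n%:~R + a + b + n%:~R * b + k.
rewrite (@eq_shifted_sum _ _ (fun i => (-1) *: z i + (- d) *: y i)).
  by rewrite shifted_sum_comb shifted_sumZ rpredD ?rpredZ.
by move=> i; rewrite /z scalerA -scalerDl; congr (_ *: _); rewrite /d; ring.
Qed.

(** Iterating the weight lemma over the other indices [l] gives the factor [q], a product of
    differences [j - l]: it vanishes at each [j] in [s] except [i], where it is nonzero in
    characteristic 0. *)
Lemma shifted_sum_isolate s y i : uniq s -> i \in s ->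
  ultimately (fun N => shifted_sum s y N \in U) ->
  ultimately (fun N => pure_tensor (e N) (y i) \in U).
Proof.
move=> us is_ yU.
pose q (r : seq int) (j : int) : K := \prod_(l <- r) (j%:~R - l%:~R).
have qU r : ultimately (fun N => shifted_sum s (fun j => q r j *: y j) N \in U).
  elim: r => [|l r IH].
    apply: ultimately_imp yU => N; apply: eq_shifted_sum_mem => j.
    by rewrite /q big_nil scale1r.
  apply: ultimately_imp (shifted_sum_weight s _ (l%:~R) IH) => N.
  apply: eq_shifted_sum_mem => j.
  by rewrite /q big_cons scalerA.
(* At the shift [N - i] the first factor of the surviving term is [e N]. *)
apply: ultimately_imp (ultimately_shift _ (- i) (qU (rem i s))) => N.
rewrite /shifted_sum (bigD1_seq i) //= big_seq_cond big1 ?addr0; last first.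
  move=> j /andP[js ji]; rewrite /q (big_rem j) /=; last first.
    by rewrite (mem_rem_uniq _ us) inE ji.
  by rewrite subrr mul0r scale0r pure_tensor0r.
rewrite pure_tensorZr (_ : i + (N - i) = N); last by lia.
move=> zU; rewrite -[pure_tensor _ _]scale1r -(@mulVf _ (q (rem i s) i)).
  by rewrite -scalerA rpredZ.
rewrite /q prodf_seq_neq0; apply/allP => j.
rewrite (mem_rem_uniq _ us) inE => /andP[ji _] /=.
by rewrite subr_eq0 eqr_int eq_sym.
Qed.

Lemma shifted_sum_eventually s y : b != 0 -> shifted_sum s y 0 \in U ->
  ultimately (fun N => shifted_sum s y N \in U).
Proof.
move=> b0 yU; have [n yn] := restricted_family s y.
(* With this bound both [k] and [N - k] are at least [n] for [k] = n, n + 1, n + 2. The scalar by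
   which L_{N-k} L_k multiplies [y i] is [f k i]. *)
exists (n + n + 2) => N nN.
pose f (k i : int) : K :=
  (i%:~R + a + b + k%:~R * b) * (i%:~R + k%:~R + a + b + (N - k)%:~R * b).
have fU k : n <= k -> n <= N - k ->
    shifted_sum s (fun i => f k i *: y i) N \in U.
  move=> nk nNk; have := U_stable (virL K (N - k)) _ (U_stable (virL K k) _ yU).
  rewrite act_shifted_sum; last exact: yn.
  rewrite act_shifted_sum; last by move=> i is_; rewrite actZ yn ?scaler0.
  rewrite (_ : 0 + k + (N - k) = N); last by lia.
  apply: eq_shifted_sum_mem => i; rewrite scalerA; congr (_ *: _).
  by rewrite /f; ring.
(* The second difference of [f] in [k], nonzero because [b] is neither 0 nor 1. *)
pose d := 2%:R * b * (1 - b).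
have d0 : d != 0.
  by rewrite /d !mulf_neq0 ?pnatr_eq0 // subr_eq0 eq_sym.
suff : d *: shifted_sum s y N \in U.
  by move=> dU; rewrite -[shifted_sum _ _ _]scale1r -(mulVf d0) -scalerA rpredZ.
(* [f] is quadratic in [k] with leading coefficient b (1 - b), so its second
   difference does not depend on [i]. *)
rewrite -shifted_sumZ (@eq_shifted_sum _ _ (fun i => (- 2%:R) *:
  (f (n + 1) i *: y i) + (1 *: (f n i *: y i) + f (n + 2) i *: y i))).
  rewrite !shifted_sum_comb rpredD ?rpredD ?rpredZ ?fU //; lia.
move=> i; rewrite !scalerA -!scalerDl; congr (_ *: _).
by rewrite /d /f; ring.
Qed.

Hypothesis L_irr : irreducible L.

Lemma ultimately_weight_tensor (t : tensor M L) (y : L) : t \in U -> t != 0 ->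
  ultimately (fun N => pure_tensor (e N) y \in U).
Proof.
have [s [z [us ->]]] := weight_expansion t => tU t0.
have [i is_ zi0] : exists2 i, i \in s & pure_tensor (e i) (z i) != 0.
  apply/hasP; apply: contraNT t0 => /hasPn z0.
  by rewrite big_seq big1 // => i /z0; rewrite negbK => /eqP.
have {zi0} [ei0 zi0] : e i <> 0 /\ z i <> 0.
  by split=> i0; move: zi0; rewrite i0 ?pure_tensor0l ?pure_tensor0r eqxx.
have sU : shifted_sum s z 0 \in U.
  by rewrite /shifted_sum; under eq_bigr do rewrite addr0.
have [w w0 wU] : exists2 w : L, w <> 0 &
    ultimately (fun N => pure_tensor (e N) w \in U).
  have [b0|b0] := eqVneq b 0; last first.
    exists (z i) => //; apply: shifted_sum_isolate us is_ _.
    exact: shifted_sum_eventually.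
  (* For [b = 0] a single L_N suffices: its scalar -(j + a) does not depend on [N], and at [i] it is
     nonzero by [e_b0]. *)
  exists ((i%:~R + a) *: z i).
    move=> /eqP; rewrite scaler_eq0 => /orP[/eqP|/eqP] //.
    by move=> /(e_b0 b0).
  apply: (@shifted_sum_isolate s (fun i => (i%:~R + a) *: z i)) us is_ _.
  have [n zn] := restricted_family s z; exists n => N nN.
  have := U_stable (virL K N) _ sU; rewrite -rpredN.
  rewrite act_shifted_sum; last exact: zn.
  rewrite add0r -scaleN1r -shifted_sumZ.
  apply: eq_shifted_sum_mem => j; rewrite scalerA b0; congr (_ *: _); ring.
have cl : submod_closed
    (fun y : L => `[< ultimately (fun N => pure_tensor (e N) y \in U) >]).
  split=> [|k x x' /asboolP xU /asboolP x'U]; apply/asboolP.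
    by exists 0 => N _; rewrite pure_tensor0r rpred0.
  apply: ultimately_imp (ultimately_and _ _ xU x'U) => N [xN x'N].
  by rewrite pure_tensorDr pure_tensorZr rpredD ?rpredZ.
have st : act_stable (Subspace cl).
  apply: vir_stable => [|n] x /asboolP xU; apply/asboolP.
    apply: ultimately_imp xU => N /(U_stable (virC K)).
    by rewrite act_pure_tensor e_actC pure_tensor0l add0r.
  apply: ultimately_imp (ultimately_and _ _ xU (ultimately_shift _ n xU)).
  move=> N [/(U_stable (virL K n))]; rewrite act_pure_tensor e_act.
  (* By the Leibniz rule, e_N (x) L_n x is L_n (e_N (x) x) minus a multiple of e_{N+n} (x) x; both
     lie in [U] for large [N]. *)
  move=> xN xNn; rewrite -[pure_tensor _ _](addKr
    (pure_tensor (- (N%:~R + a + b + n%:~R * b) *: e (N + n)) x)).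
  by rewrite rpredD ?rpredN // pure_tensorZl rpredZ.
have [S0|/(_ y)/asboolP //] := L_irr.2 _ st.
by case: w0; apply/S0/asboolP.
Qed.

End WeightBasis.

(** * Weight bases of the modules V'_{alpha,beta} *)

Section VprimeBasis.
Variable K : numFieldType.
Implicit Types (a b : K) (s : vab_case).

(** The type [Vprime_case] depends on [s]; keeping [s] a variable, with [case_spec] recording what
    it says about the parameters, permits case analysis. *)
Definition case_index s (m : int) : bool :=
  match s with Case00 => m != 0 | Case01 => m != -1 | Case_generic => true end.

Definition case_spec a b s : Prop :=
  match s with
  | Case00 => a = 0 /\ b = 0
  | Case01 => a = 0 /\ b = 1
  | Case_generic => (a = 0 -> b <> 0) /\ (a = 0 -> b <> 1)
  end.

Lemma vab_case_ofP a b : case_spec a b (vab_case_of a b).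
Proof.
rewrite /vab_case_of; case: (a =P 0) => [->|a0] //=; case: (b =P 0) => //= b0.
by case: (b =P 1).
Qed.

(** A normalized parameter is 0 or not an integer. *)
Lemma normalize_int a (k : int) : k%:~R + normalize a = 0 -> normalize a = 0 /\ k = 0.
Proof.
rewrite /normalize; case: asboolP => [_|aN] /eqP.
  by rewrite addr0 intr_eq0 => /eqP.
rewrite addrC addr_eq0 => /eqP ak; case: aN.
by exists (- k); rewrite ak mulrNz.
Qed.

Lemma vprime_case_out a b s m : ~~ case_index s m -> vprime_case a b s m = 0.
Proof.
case: s => //=; rewrite negbK => /eqP ->.
  by apply/qproj0/mem_span.
apply/val_inj; rewrite val_insubd; case: ifP => // vN1.
(* The coefficient at [-1] vanishes on the span of the other v_m, so v_{-1} lies outside it and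
   [insubd] returns its default 0. *)
have cl : submod_closed (fun u : Vab (0 : K) 1 => u@_(-1) == 0).
  split=> [|k u w /eqP u0 /eqP w0]; rewrite unfold_in; first by rewrite mcoeff0.
  by rewrite mcoeffD mcoeffZ u0 w0 mulr0 addr0.
have : vab (0 : K) 1 (-1) \in Subspace cl.
  apply: span_sub vN1 => u [i iN1 ->].
  by rewrite unfold_in mcoeffU (negPf iN1).
by rewrite unfold_in mcoeffU eqxx oner_eq0.
Qed.

Lemma act_vprime_case a b s n m : case_spec a b s -> case_index s m ->
  act (virL K n) (vprime_case a b s m) =
  (- (m%:~R + a + b + n%:~R * b)) *: vprime_case a b s (m + n).
Proof.
case: s => /= [[-> ->] m0|[-> ->] mN1|_ _]; last exact: act_virL_vab.
  rewrite (quot_actE (@line_v0_stable K)) act_virL_vab; exact: linearZ.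
apply/val_inj; change (act (virL K n) (val (vprime_case a b Case01 m)) =
  (- (m%:~R + 0 + 1 + n%:~R * 1)) *: val (vprime_case a b Case01 (m + n))).
rewrite val_vprime_case01 // act_virL_vab.
(* If the action would reach the missing index, its coefficient -(m + 1 + n) is 0. *)
have [mn|mn] := eqVneq (m + n) (-1); last by rewrite val_vprime_case01.
have -> : n = -1 - m by lia.
by rewrite (_ : - _ = 0) ?scale0r //; ring.
Qed.

Lemma act_virC_vprime_case a b s m : act (virC K) (vprime_case a b s m) = 0.
Proof.
have [idx|out] := boolP (case_index s m); last first.
  by rewrite vprime_case_out // act0r.
case: s idx => /= idx; last exact: act_virC_vab.
  by rewrite /= (quot_actE (@line_v0_stable K)) act_virC_vab linear0.
apply/val_inj; change (act (virC K) (val (vprime_case a b Case01 m)) = 0).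
by rewrite val_vprime_case01 // act_virC_vab.
Qed.

Lemma vprime_case_span a b s (S : subspace (Vprime_case a b s)) :
  (forall m, case_index s m -> vprime_case a b s m \in S) -> forall u, u \in S.
Proof.
case: s S => /= S Sv u.
- rewrite -[u]qprojK; elim/malg_ind_lin: (repr u) => [|k m w IH].
    by rewrite linear0 rpred0.
  rewrite linearP rpredD ?rpredZ //.
  have [->|m0] := eqVneq m 0; last exact: Sv.
  have v00 : qproj (line_v0 K) (vab 0 0 0) = 0 by apply/qproj0/mem_span.
  exact: (eq_ind_r (fun q => q \in S) (rpred0 S) v00).
(* The image of [S] in the ambient V_{0,1} is a subspace there, so it can be compared with the span
   that defines the submodule. *)
- pose P (w : Vab (0 : K) 1) := exists2 u : Vprime_case a b Case01, val u = w & u \in S.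
  have cl : submod_closed (fun w => `[< P w >]).
    split=> [|k w w' /asboolP[x <- xS] /asboolP[y <- yS]]; apply/asboolP.
      by exists 0; rewrite ?rpred0.
    by exists (k *: x + y); rewrite ?rpredD ?rpredZ.
  have : val u \in Subspace cl.
    apply: span_sub (valP u) => w [m mN1 ->]; apply/asboolP.
    by exists (vprime_case a b Case01 m); [exact: val_vprime_case01|exact: Sv].
  by move=> /asboolP[x /val_inj <-].
- by elim/malg_ind_lin: u => [|k m w IH]; rewrite ?rpred0 // rpredD ?rpredZ ?Sv.
Qed.

(** The functional is the coordinate at [m]; in [Case00] it descends to the quotient because it
    vanishes on the line of v_0. *)
Lemma vprime_case_coord a b s m : case_index s m ->
  exists2 f : Vprime_case a b s -> K,
    linear (f : _ -> K^o) & f (vprime_case a b s m) != 0.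
Proof.
have lin (x y : K) : linear (fun u : Vab x y => u@_m : K^o).
  by move=> k u w; rewrite mcoeffD mcoeffZ.
case: s => /= idx.
- have ker u : u \in line_v0 K -> u@_m = 0.
    move=> uS; have cl : submod_closed (fun u : Vab (0 : K) 0 => u@_m == 0).
      split=> [|k x y /eqP x0 /eqP y0]; rewrite unfold_in; first by rewrite mcoeff0.
      by rewrite mcoeffD mcoeffZ x0 y0 mulr0 addr0.
    apply/eqP; apply: (@span_sub _ _ _ (Subspace cl)) uS => w ->.
    by rewrite unfold_in mcoeffU (eq_sym 0) (negPf idx).
  have reprE u : (repr (qproj (line_v0 K) u))@_m = u@_m.
    by apply/eqP; rewrite -subr_eq0 -mcoeffB ker ?qproj_repr.
  exists (fun q => (repr q)@_m); last by rewrite reprE /vab mcoeffU eqxx oner_eq0.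
  move=> k p q; rewrite -[p]qprojK -[q]qprojK -linearP !reprE.
  by rewrite mcoeffD mcoeffZ.
- exists (fun u => (val u)@_m); first by move=> k u w; rewrite /= mcoeffD mcoeffZ.
  by rewrite val_vprime_case01 // /vab mcoeffU eqxx oner_eq0.
- by exists (fun u => u@_m); [exact: lin|rewrite /vab mcoeffU eqxx oner_eq0].
Qed.

(* For [b = 1], rescaling v_m by m + a + 1 gives the relations of V_{a+1,0}; the
   factor vanishes only at the index missing from V'_{0,1}. *)
Lemma vprime_case_weight_basis a b s : case_spec a b s ->
  (forall k : int, k%:~R + a = 0 -> a = 0 /\ k = 0) ->
  exists a' b' (r : int -> K) (e := fun m => r m *: vprime_case a b s m),
  [/\ b' != 1,
      forall n m, act (virL K n) (e m) =
        (- (m%:~R + a' + b' + n%:~R * b')) *: e (m + n),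
      b' = 0 -> forall m, m%:~R + a' = 0 -> e m = 0
    & forall m, case_index s m -> r m != 0].
Proof.
move=> spec a_int; have [b1|b1] := eqVneq b 1.
  exists (a + 1), 0, (fun m => m%:~R + a + 1); split=> [|n m|_ m|m idx].
  - by rewrite eq_sym oner_eq0.
  - rewrite actZ; have [idx|out] := boolP (case_index s m).
      rewrite act_vprime_case // !scalerA; congr (_ *: _); rewrite b1; ring.
    (* When [b = 1] only [Case01] has a missing index, and there the coefficient vanishes as
       well. *)
    rewrite vprime_case_out // act0r scaler0 (_ : - _ = 0) ?scale0r //.
    case: s spec out => /= [[_ b0]|[a0 _]|//] /negbNE/eqP ->.
      by move: b1; rewrite b0 => /esym/eqP; rewrite oner_eq0.
    by rewrite a0; ring.
  - by rewrite addrA => ->; rewrite scale0r.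
  - apply/eqP => ma; have [a0 m1] : a = 0 /\ m + 1 = 0.
      by apply: a_int; rewrite -ma; ring.
    case: s spec idx => /= [[_ b0]|_|[_ /(_ a0) //]].
      by move: b1; rewrite b0 => /esym/eqP; rewrite oner_eq0.
    by lia.
exists a, b, (fun=> 1); split=> // [n m|b0 m ma|m _]; last exact: oner_neq0.
- rewrite !scale1r; have [idx|out] := boolP (case_index s m).
    exact: act_vprime_case.
  rewrite vprime_case_out // act0r (_ : - _ = 0) ?scale0r //.
  case: s spec out => /= [[-> ->]|[_ b1']|//]; last by rewrite b1' eqxx in b1.
  by move=> /negbNE/eqP ->; ring.
(* Here [a], [b] and [m] are all 0: this is the vanishing image of v_0 in [Case00]. *)
- have [a0 m0] := a_int _ ma; rewrite scale1r vprime_case_out // m0.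
  case: s spec => //= [[_ b1']|[/(_ a0) //]].
  by rewrite b1' eqxx in b1.
Qed.

End VprimeBasis.

(** * The irreducibility criterion *)

Section Criterion.
Variables (K : numFieldType) (alpha beta c h : K).
Variables (L : lieModule (Vir K)) (v : L).
Hypothesis hL : is_irreducible_Verma_quotient c h v.

Lemma pure_vprime_neq0 m : vprime_index alpha beta m ->
  pure_tensor (vprime alpha beta m) v != 0.
Proof.
move=> idx; have [f f_lin fm] := vprime_case_coord K (normalize alpha) beta _ _ idx.
exact: (pure_tensor_neq0 _ _ _ _ f _ _ f_lin fm (Verma_quotient_neq0 _ _ _ _ _ hL)).
Qed.

Lemma vprime_index_pos m : 0 < m -> vprime_index alpha beta m.
Proof. by rewrite /vprime_index; case: vab_case_of => // m0; lia. Qed.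

Lemma submodule_contains_vprime (S : subspace (tensor (Vprime alpha beta) L)) t :
  act_stable S -> t \in S -> t != 0 ->
  exists2 m, vprime_index alpha beta m & pure_tensor (vprime alpha beta m) v \in S.
Proof.
move=> Sst tS t0.
have [a [b [r [b1 e_act e_b0 r0]]]] := vprime_case_weight_basis _ _ _ _
  (vab_case_ofP K (normalize alpha) beta) (normalize_int K alpha).
pose e m : Vprime alpha beta := r m *: vprime alpha beta m.
have e_actC m : act (virC K) (e m) = 0.
  by rewrite /e actZ [act _ _]act_virC_vprime_case scaler0.
have e_span u : u \in Defs.span (fun x => exists m, x = e m).
  apply: vprime_case_span => m idx.
  have em : e m \in Defs.span (fun x => exists m, x = e m).
    by apply: mem_span; exists m.
  rewrite -[vprime_case _ _ _ _]scale1r -(mulVf (r0 m idx)) -scalerA.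
  exact: rpredZ.
have [n Sn] := ultimately_weight_tensor _ _ _ _ _ b1 e_act e_actC e_span e_b0 _
  (Verma_quotient_restricted _ _ _ _ _ hL) _ Sst hL.1 t v tS t0.
(* Positive indices are never missing, so the scaling factor [r m] is nonzero and can be divided
   out. *)
pose m := Order.max n 1; have idx : vprime_index alpha beta m.
  by apply: vprime_index_pos; lia.
have : r m *: pure_tensor (vprime alpha beta m) v \in S.
  by rewrite -pure_tensorZl; apply: Sn; lia.
by move=> rS; exists m; rewrite // -[pure_tensor _ _]scale1r -(mulVf (r0 m idx))
  -scalerA rpredZ.
Qed.

(** Each v_m (x) v is nonzero, hence generates an irreducible module; conversely every nonzero
    submodule contains one of these vectors. *)
Lemma tensor_irreducibleP :
  irreducible (tensor (Vprime alpha beta) L) <->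
  (forall m : int, vprime_index alpha beta m ->
     cyclic_on (pure_tensor (vprime alpha beta m) v)).
Proof.
split=> [[_ irr] m idx S Sst mS|cyc].
  have [S0|//] := irr S Sst.
  by have := pure_vprime_neq0 _ idx; rewrite (S0 _ mS) eqxx.
split; first by exists (pure_tensor (vprime alpha beta 1) v);
  apply/pure_vprime_neq0/vprime_index_pos.
move=> S Sst; have [[t [tS t0]]|S0] := pselect (exists t, t \in S /\ t != 0).
  have [m idx mS] := submodule_contains_vprime _ _ Sst tS t0.
  by right; apply: cyc mS.
left=> u uS; apply/eqP/negPn/negP => u0; by apply: S0; exists u.
Qed.

End Criterion.

Theorem theorem3p2 (R : realType) (alpha beta c h : R[i])
    (L : lieModule (Vir R[i])) (v : L)
    (hL : is_irreducible_Verma_quotient c h v) :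
  irreducible (tensor (Vprime alpha beta) L) <->
  (forall m : int, vprime_index alpha beta m ->
     cyclic_on (pure_tensor (vprime alpha beta m) v)).
Proof. exact: (@tensor_irreducibleP R[i] alpha beta c h L v hL). Qed.
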